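(* Let $p\in\mathbb{C}\setminus\mathbb{Z}_{\leqslant 0}$ and $m,n\in\mathbb{Z}_{\geqslant 0}$. Then \[ \begin{aligned} \sum_{k=1}^{\infty}\frac{(-1)^nH_{k-1}}{k\,(p+n+k)^{m+1}\binom{n+k}{k}} &=\frac12\sum_{k=0}^{n}\frac{(-1)^k}{(p+k)^{m+1}}\binom{n}{k}\left\{H_n^2+H_n^{(2)}-H_{n-k}^2-H_{n-k}^{(2)}\right\}\\ &\quad+\frac{(-1)^m}{2\,m!}\,\frac{\partial^m}{\partial s^m}\left[\left(\frac{\partial^2}{\partial x^2}-2H_n\frac{\partial}{\partial x}\right)\frac{\Gamma(x+1)\Gamma(s)}{\Gamma(x+s+1)}\right]_{x=n,\,s=p}. \end{aligned} \]
   Context: $\Gamma$ is Euler's gamma function. $H_n^{(s)}=\sum_{j=1}^{n}j^{-s}$ are the generalized harmonic numbers, $H_n=H_n^{(1)}$, $H_0=H_0^{(2)}=0$. $\binom{a}{b}$ is the usual binomial coefficient. *)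

(* Defs.v *)
From HB Require Import structures.
From mathcomp Require Import all_boot all_order all_algebra complex.
From mathcomp Require Import all_classical all_reals all_analysis.
Set Implicit Arguments. Unset Strict Implicit. Unset Printing Implicit Defensive.
Import Order.TTheory GRing.Theory Num.Theory.
Export numFieldNormedType.Exports.
Local Open Scope ring_scope.
Local Open Scope complex_scope.
Local Open Scope classical_set_scope.

(* Limits and derivatives of complex-valued maps are taken in R[i]^o, i.e. R[i]
   as a normed space over itself: R[i] alone carries no topology, and derive1n
   over R[i] is the iterated complex derivative. *)

Definition cexp (R : realType) (z : R[i]) : R[i] :=
  (expR (complex.Re z) * cos (complex.Im z)) +i*
  (expR (complex.Re z) * sin (complex.Im z)).

(* N ^ z for a positive integer N, with the real logarithm of N. *)
Definition natcpow (R : realType) (N : nat) (z : R[i]) : R[i] :=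
  cexp (z * (ln (N%:R : R))%:C).

(* Euler's limit  Gamma(z) = lim_N  N! N^z / (z (z+1) ... (z+N)), which
   converges at every complex z that is not a nonpositive integer; at the poles
   every late term is x / 0 = 0, so the value there is a meaningless 0. *)
Definition Gamma (R : realType) (z : R[i]) : R[i] :=
  lim ((N`!%:R * natcpow N z / \prod_(0 <= j < N.+1) (z + j%:R) : R[i]^o)
         @[N --> \oo]).

(* H_n^(s); only natural exponents s are needed. *)
Definition gharm (R : realType) (s n : nat) : R[i] :=
  \sum_(1 <= j < n.+1) (j%:R ^+ s)^-1.

Definition Gamma_quot (R : realType) (x s : R[i]) : R[i]^o :=
  Gamma (x + 1) * Gamma s / Gamma (x + s + 1).

(* Main.v *)
(** For [x = n + y] with [|y| < 1], [Gamma (x+1) Gamma s / Gamma (x+s+1)] is the Newton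
    series [sum_k (-1)^k binom(x, k) / (s + k)].  Indeed Euler's limits combine to
    [N! prod_(j <= N) (x+s+1+j) / (prod (x+1+j) prod (s+j))]; expanding this in partial
    fractions in [s] gives the terms of the series weighted by factors of modulus at most 1
    that tend to 1, plus a constant that tends to 0, and Tannery's theorem applies.

    The polynomials [y |-> binom(n+y, k)] have majorants whose quotients by [k+1] telescope
    to a convergent series, so the Newton series may be differentiated termwise, any number
    of times in [y] at [0] and then in [s].  Applying [d^2/dx^2 - 2 H_n d/dx] to [binom(x, k)]
    at [x = n] produces, up to sign, the bracket of harmonic numbers for [k <= n] and the
    summand of the left-hand side for [k > n]. *)
Require Import Defs.
From HB Require Import structures.
From mathcomp Require Import all_boot all_order all_algebra complex.
From mathcomp Require Import all_classical all_reals all_analysis.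
From mathcomp Require Import ring lra.
Import Order.TTheory GRing.Theory Num.Theory.
Set Implicit Arguments. Unset Strict Implicit. Unset Printing Implicit Defensive.
Local Open Scope ring_scope.
Local Open Scope complex_scope.
Local Open Scope classical_set_scope.
Import Normc.

Local Notation "u ~> l" :=
  ((u : nat -> (complex _)^o) @ \oo --> (l : (complex _)^o)) (at level 70).

Section ComplexModulus.
Variable R : realType.
Implicit Types (z w : R[i]) (x y : R).

Lemma normrcE z : `|z| = (normc z)%:C.
Proof. by []. Qed.

Lemma normc_ge0 z : 0 <= normc z.
Proof. exact: (@normr_ge0 R (Rcomplex R)). Qed.

Lemma normc_gt0 z : (0 < normc z) = (z != 0).
Proof. exact: (@normr_gt0 R (Rcomplex R)). Qed.

Lemma ler_normcB z w : normc (z - w) <= normc z + normc w.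
Proof. exact: (@ler_normB R (Rcomplex R)). Qed.

Lemma normc_distC z w : normc (z - w) = normc (w - z).
Proof. exact: (@distrC R (Rcomplex R)). Qed.

Lemma lerB_normcD z w : normc z - normc w <= normc (z + w).
Proof. exact: (@lerB_normD R (Rcomplex R)). Qed.

Lemma ler_normc_sum (I : Type) (r : seq I) (P : pred I) (F : I -> R[i]) :
  normc (\sum_(i <- r | P i) F i) <= \sum_(i <- r | P i) normc (F i).
Proof. exact: (@ler_norm_sum R (Rcomplex R)). Qed.

Lemma normc_prod (I : Type) (r : seq I) (P : pred I) (F : I -> R[i]) :
  normc (\prod_(i <- r | P i) F i) = \prod_(i <- r | P i) normc (F i).
Proof. exact: (big_morph _ (@normcM R) (@normc1 R)). Qed.

Lemma normcX z n : normc (z ^+ n) = normc z ^+ n.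
Proof. by elim: n => [|n IHn]; rewrite ?normc1 // !exprS normcM IHn. Qed.

Lemma normc_real x : normc x%:C = `|x|.
Proof. by rewrite /normc /= expr0n /= addr0 sqrtr_sqr. Qed.

Lemma normc_nat n : normc (n%:R : R[i]) = n%:R.
Proof. by rewrite normcMn normc1. Qed.

Lemma normc_sign n : normc ((-1) ^+ n : R[i]) = 1.
Proof. by rewrite normcX normcN normc1 expr1n. Qed.

Lemma Re_le_normc z : `|complex.Re z| <= normc z.
Proof. by rewrite -lecR; exact: normc_ge_Re. Qed.

Lemma normc_le_ReIm z : normc z <= `|complex.Re z| + `|complex.Im z|.
Proof.
have {1}-> : z = (complex.Re z)%:C + 'i * (complex.Im z)%:C.
  by case: z => a b; simpc.
apply: le_trans (le_normcD _ _) _.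
by rewrite normcM !normc_real /= expr0n expr1n add0r sqrtr1 mul1r.
Qed.

Lemma Im_le_normc z : `|complex.Im z| <= normc z.
Proof.
have := Re_le_normc (- 'i * z); rewrite normcM normcN.
have -> : normc ('i : R[i]) = 1 by rewrite /normc /= expr0n expr1n add0r sqrtr1.
by rewrite mul1r; case: z => a b; simpc.
Qed.

End ComplexModulus.

Section ComplexSequences.
Variable R : realType.
Implicit Types (u v : nat -> R[i]) (l : R[i]).

Lemma cvg_normcP u l : u ~> l <-> normc (u n - l) @[n --> \oo] --> (0 : R).
Proof.
have normE n (e : R) : (`|0 - normc (u n - l)| < e) = (normc (l - u n) < e).
  by rewrite sub0r normrN ger0_norm ?normc_ge0 // normc_distC.
split=> /cvgrPdist_lt ul; apply/cvgrPdist_lt.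
  move=> e e0; have /ul : 0 < e%:C by rewrite ltcR.
  by apply: filterS => n; rewrite normE -ltcR.
move=> -[e f]; rewrite ltcE /= => /andP[/eqP -> /ul].
by apply: filterS => n; rewrite normE -ltcR.
Qed.

(* Restated over [R[i]]: inference does not find the topology of [R[i]^o] from the
   operations of [R[i]]. *)
Lemma cvgc_cst l : (fun=> l) ~> l.
Proof. exact: cvg_cst. Qed.

Lemma cvgcD u v l l' : u ~> l -> v ~> l' -> (fun n => u n + v n) ~> l + l'.
Proof. exact: cvgD. Qed.

Lemma cvgcB u v l l' : u ~> l -> v ~> l' -> (fun n => u n - v n) ~> l - l'.
Proof. exact: cvgB. Qed.

Lemma cvgcM u v l l' : u ~> l -> v ~> l' -> (fun n => u n * v n) ~> l * l'.
Proof. exact: cvgM. Qed.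

Lemma cvgcMl (a : R[i]) u l : u ~> l -> (fun n => a * u n) ~> a * l.
Proof. exact/cvgcM/cvgc_cst. Qed.

Lemma cvgcV u l : l != 0 -> u ~> l -> (fun n => (u n)^-1) ~> l^-1.
Proof. exact: cvgV. Qed.

Lemma cvgc_lim u l : u ~> l -> lim ((u : nat -> R[i]^o) @ \oo) = l.
Proof. by move=> ul; apply: cvg_lim => //; exact: norm_hausdorff. Qed.

Lemma eq_cvgc u v l : u =1 v -> u ~> l -> v ~> l.
Proof. by move=> /funext ->. Qed.

Lemma cvgc_shiftn N u l : u ~> l -> (fun n => u (n + N)%N) ~> l.
Proof. by rewrite -(cvg_shiftn N). Qed.

Lemma cvgc_unique u l l' : u ~> l -> u ~> l' -> l = l'.
Proof. by move=> /cvgc_lim <- /cvgc_lim <-. Qed.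

Lemma cvg_normc u l : u ~> l -> normc (u n) @[n --> \oo] --> normc l.
Proof.
move=> /cvg_normcP ul; apply/subr_cvg0/norm_cvg0P.
apply: (squeeze_cvgr _ (cvg_cst 0) ul); apply: nearW => n.
by rewrite normr_ge0 (@ler_dist_dist R (Rcomplex R)).
Qed.

Lemma normc_cvg_le u l (B : R) : u ~> l -> (forall n, normc (u n) <= B) ->
  normc l <= B.
Proof. by move=> /cvg_normc ul uB; apply: (cvgr_to_le ul); exact: nearW. Qed.

Lemma cvg_normc_le u l (v : nat -> R) : (forall n, normc (u n - l) <= v n) ->
  v @ \oo --> 0 -> u ~> l.
Proof.
move=> ulv v0; apply/cvg_normcP; apply: (squeeze_cvgr _ (cvg_cst 0) v0).
by apply: nearW => n; rewrite normc_ge0 ulv.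
Qed.

Lemma cvg_ReIm u (a b : R) : complex.Re (u n) @[n --> \oo] --> a ->
  complex.Im (u n) @[n --> \oo] --> b -> u ~> a +i* b.
Proof.
move=> ua ub.
apply: (@cvg_normc_le _ _ (fun n => `|complex.Re (u n) - a| + `|complex.Im (u n) - b|)).
  by move=> n; have := normc_le_ReIm (u n - (a +i* b)); case: (u n).
rewrite -[0 in X in _ --> X]addr0; apply: cvgD; exact/norm_cvg0P/subr_cvg0.
Qed.

Lemma cvg_neq0_bounded_below u l : u ~> l -> l != 0 -> (forall n, u n != 0) ->
  exists2 c : R, 0 < c & forall n, c <= normc (u n).
Proof.
move=> /cvg_normc ul l0 u0.
have /cvgV/(_ ul)/cvgP/cvg_seq_bounded : normc l != 0 by rewrite gt_eqF ?normc_gt0.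
move=> /pinfty_ex_gt0[M M0 uM]; exists M^-1; rewrite ?invr_gt0 // => n.
rewrite -[normc _]invrK lef_pV2 ?posrE ?invr_gt0 ?normc_gt0 //.
by apply: le_trans (ler_norm _) _; exact: uM.
Qed.

End ComplexSequences.
Arguments cvgc_cst {R} l.
Arguments cvgc_shiftn {R} N {u l}.
Arguments cvgcMl {R} a {u l}.
Arguments eq_cvgc {R u v l}.

Section RealSeries.
Variable R : realType.
Implicit Types a d u v M : R ^nat.

Lemma series_leZ_cvg (c : R) u v : (forall n, 0 <= u n) ->
  (forall n, u n <= c * v n) -> cvgn (series v) -> cvgn (series u).
Proof.
move=> u0 uv /(@is_cvg_seriesZ _ _ c); apply: series_le_cvg => // n.
exact: le_trans (uv n).
Qed.

Lemma series_le_telescope_cvg N a d : (forall n, 0 <= a n) -> (forall n, 0 <= d n) ->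
  (forall n, (N <= n)%N -> a n <= d n - d n.+1) -> cvgn (series a).
Proof.
move=> a0 d0 ad; rewrite -(is_cvg_series_restrict N).
apply: nondecreasing_is_cvgn; first exact: nondecreasing_series.
exists (d N) => _ [n _ <-]; have [nN|/ltnW Nn] := leqP n N; first by rewrite /= big_geq.
apply: (@le_trans _ _ (\sum_(N <= k < n) (- d k.+1 - - d k))).
  by apply: ler_sum_nat => k /andP[/ad]; rewrite opprK addrC.
by rewrite telescope_sumr // opprK addrC gerBl.
Qed.

Lemma series_inv_sqr_cvg : cvgn (series (fun n => (n.+1%:R ^- 2) : R)).
Proof.
apply: (@series_le_telescope_cvg 0 _ (fun n => 2 / n.+1%:R)) => n; rewrite ?divr_ge0 // => _.
rewrite -[n.+2%:R]natr1; have : 1 <= n.+1%:R :> R by rewrite ler1n.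
move: (n.+1%:R : R) => x x1; rewrite -subr_ge0.
rewrite (_ : _ - _ = (x - 1) / (x ^+ 2 * (x + 1))); last by field; rewrite !gt_eqF //; lra.
by rewrite divr_ge0 ?mulr_ge0 ?sqr_ge0 //; lra.
Qed.

Lemma series_dominated_cvg0 (a : nat -> R ^nat) M : (forall n k, 0 <= a n k <= M k) ->
    cvgn (series M) -> (forall k, a n k @[n --> \oo] --> 0) ->
  series (a n) n @[n --> \oo] --> 0.
Proof.
move=> aM M_cvg a0; have M0 k : 0 <= M k by have /andP[/le_trans] := aM 0%N k; exact.
have M_nondecr : nondecreasing_seq (series M) by exact: nondecreasing_series.
have head0 K : series (a n) K @[n --> \oo] --> 0.
  elim: K => [|K IH].
    rewrite (_ : (fun n => _) = cst 0); first exact: cvg_cst.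
    by apply/funext => n; rewrite /series /= big_geq.
  rewrite (_ : (fun n => _) = (fun n => series (a n) K) + a^~ K); last first.
    by apply/funext => n; exact: seriesSr.
  by rewrite -[0 in X in _ --> X]addr0; exact: cvgD.
apply/cvgrPdist_lt => e e0; have e2 : 0 < e / 2 by rewrite divr_gt0.
have /cvgrPdist_lt/(_ _ e2)[K _ /(_ K (leqnn K)) tailM] := M_cvg.
have /cvgrPdist_lt/(_ _ e2) := head0 K; apply: filter_app.
near=> n; rewrite !sub0r !normrN => head_lt.
have Kn : (K <= n)%N by near: n; exact: nbhs_infty_ge.
rewrite -(subrK (series (a n) K) (series (a n) n)) (splitr e).
apply: le_lt_trans (ler_normD _ _) (ler_ltD _ head_lt).
rewrite sub_series_geq // ger0_norm; last first.
  by apply: sumr_ge0 => k _; have /andP[] := aM n k.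
apply: le_trans (ltW tailM); apply: le_trans (ler_norm _).
apply: (@le_trans _ _ (series M n - series M K)).
  by rewrite sub_series_geq //; apply: ler_sum => k _; have /andP[] := aM n k.
by rewrite lerD2r; exact: nondecreasing_cvgn_le.
Unshelve. all: by end_near. Qed.

End RealSeries.

Section ComplexSeries.
Variable R : realType.
Implicit Types (u c : nat -> R[i]).

Lemma normc_series_cvg u : cvgn [series normc (u k)]_k -> exists l : R[i], series u ~> l.
Proof.
move=> u_cvg; have comp_cvg (f : R[i] -> R) : {morph f : z w / z + w} -> f 0 = 0 ->
    (forall z, `|f z| <= normc z) -> exists a : R, f (series u n) @[n --> \oo] --> a.
  move=> fD f0 fle; have : cvgn (series (f \o u)).
    apply: normed_cvg; apply: series_le_cvg u_cvg => n /=.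
    - exact: normr_ge0.
    - exact: normc_ge0.
    - exact: fle.
  move=> /cvg_ex[a fa]; exists a; rewrite (_ : (fun n => _) = series (f \o u)) //.
  by apply/funext => n; rewrite /series /= (big_morph f fD f0).
have [|//||a ua] := comp_cvg (@complex.Re R); [by case=> ? ? []|exact: Re_le_normc|].
have [|//||b ub] := comp_cvg (@complex.Im R); [by case=> ? ? []|exact: Im_le_normc|].
by exists (a +i* b); exact: cvg_ReIm.
Qed.

Lemma tannery (b : nat -> nat -> R[i]) c (M : nat -> R) l :
    (forall n k, normc (b n k) <= M k) -> cvgn (series M) ->
    (forall k, b^~ k ~> c k) -> series c ~> l ->
  (fun n => series (b n) n) ~> l.
Proof.
move=> b_le M_cvg bc /cvg_normcP cl.
have c_le k : normc (c k) <= M k by exact: normc_cvg_le (bc k) _.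
pose a n k := normc (b n k - c k).
have a0 : series (a n) n @[n --> \oo] --> (0 : R).
  apply: (@series_dominated_cvg0 _ _ (fun k => 2 * M k)); last by move=> k; exact/cvg_normcP.
    move=> n k; rewrite normc_ge0 /=; apply: le_trans (ler_normcB _ _) _.
    by rewrite mulrDl mul1r lerD.
  exact: is_cvg_seriesZ M_cvg.
apply: (@cvg_normc_le _ _ _ (fun n => series (a n) n + normc (series c n - l))).
  move=> n; rewrite -[_ - l](subrKA (series c n)).
  apply: le_trans (le_normcD _ _) _; rewrite lerD2r -sumrB.
  exact: ler_normc_sum.
by rewrite -[0 in X in _ --> X]addr0; exact: cvgD.
Qed.

End ComplexSeries.

Section InfiniteProducts.
Variable R : realType.
Implicit Types a : nat -> R[i].

Lemma prod_cvg a : cvgn [series normc (a k - 1)]_k ->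
  exists l : R[i], (fun n => \prod_(k < n) a k) ~> l.
Proof.
move=> a_cvg; pose u n := \prod_(k < n) a k.
have sum_nondecr : nondecreasing_seq [series normc (a k - 1)]_k.
  by apply: nondecreasing_series => k _ _; exact: normc_ge0.
have u_bound n : normc (u n) <= expR (limn [series normc (a k - 1)]_k).
  apply: (@le_trans _ _ (expR ([series normc (a k - 1)]_k n))); last first.
    by rewrite ler_expR; exact: nondecreasing_cvgn_le.
  rewrite normc_prod seriesEord /= expR_sum; apply: ler_prod => k _.
  rewrite normc_ge0; apply: le_trans (expR_ge1Dx _).
  by have := le_normcD 1 (a k - 1); rewrite normc1 addrC subrK.
have [|l ul] := @normc_series_cvg _ (fun k => u k * (a k - 1)).
  apply: series_leZ_cvg a_cvg => k /=; first exact: normc_ge0.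
  by rewrite normcM ler_wpM2r ?normc_ge0.
exists (1 + l); apply: eq_cvgc _ (cvgcD (cvgc_cst 1) ul).
elim=> [|n IHn]; first by rewrite big_ord0 /series /= big_geq ?addr0.
by rewrite seriesSr addrA IHn big_ord_recr /= mulrBr mulr1 addrC subrK.
Qed.

Lemma prod_cvg_neq0 a : cvgn [series normc (a k - 1)]_k -> (forall k, a k != 0) ->
  exists2 l : R[i], (fun n => \prod_(k < n) a k) ~> l & l != 0.
Proof.
move=> a_cvg a0; have [l al] := prod_cvg a_cvg.
have a1 : a ~> 1 by apply/cvg_normcP; exact: cvg_series_cvg_0 a_cvg.
have [c c0 a_ge] := cvg_neq0_bounded_below a1 (oner_neq0 _) a0.
have [|l' al'] := @prod_cvg (fun k => (a k)^-1).
  apply: (@series_leZ_cvg _ c^-1) a_cvg => k /=; first exact: normc_ge0.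
  have -> : (a k)^-1 - 1 = (1 - a k) / a k by field; exact: a0.
  rewrite normcM normcV normc_distC mulrC ler_wpM2r ?normc_ge0 //.
  by rewrite lef_pV2 ?posrE // (lt_le_trans c0 (a_ge k)).
exists l => //; have ll' : l * l' = 1.
  apply: cvgc_unique (cvgc_cst 1); apply: eq_cvgc _ (cvgcM al al') => n.
  by rewrite -big_split big1 // => k _; rewrite /= divff.
by apply: contra_eq_neq ll' => ->; rewrite mul0r eq_sym oner_neq0.
Qed.

End InfiniteProducts.

Section ComplexDerivatives.
Variable R : realType.
Implicit Types (F : R[i] -> R[i]^o) (x h g : R[i]).

Lemma derive1_quadratic F x g (K d : R) : 0 < d ->
    (forall h, normc h < d -> normc (F (x + h) - F x - h * g) <= K * normc h ^+ 2) ->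
  derive1 F x = g.
Proof.
move=> d0 FK; apply: cvg_lim; first exact: norm_hausdorff.
apply/cvgrPdist_lt => -[e f]; rewrite ltcE /= => /andP[/eqP -> e0].
pose B := `|K| + 1; have B_gt0 : 0 < B by rewrite ltr_wpDl.
apply/nbhs_ballP; exists (Num.min d (e / B))%:C.
  by rewrite /= ltcR lt_min d0 divr_gt0.
move=> h; rewrite /ball /= sub0r normrN normrcE ltcR lt_min => /andP[hd he] h0.
suff : normc (g - h^-1 * (F (h + x) - F x)) < e by rewrite -ltcR; exact.
have -> : g - h^-1 * (F (h + x) - F x) = - (h^-1 * (F (x + h) - F x - h * g)).
  by rewrite [h + x]addrC; field.
rewrite normcN normcM normcV mulrC ltr_pdivrMr ?normc_gt0 //.
apply: le_lt_trans (FK _ hd) _; rewrite expr2 mulrA ltr_pM2r ?normc_gt0 //.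
rewrite ltr_pdivlMr // mulrC in he; apply: le_lt_trans he.
by rewrite ler_wpM2r ?normc_ge0 // /B (le_trans (ler_norm K)) // lerDl.
Qed.

(* The quadratic remainders are summable, so convergence of the series at two
   points already forces the series of derivatives to converge. *)
Lemma derive1_series (f : nat -> R[i] -> R[i]) (g : nat -> R[i]) (M : nat -> R)
    F x (d : R) : 0 < d -> cvgn (series M) ->
    (forall k h, normc h < d ->
       normc (f k h - f k 0 - h * g k) <= M k * normc h ^+ 2) ->
    (forall h, normc h < d -> series (f^~ h) ~> F (x + h)) ->
  series g ~> derive1 F x.
Proof.
move=> d0 M_cvg fgM fF.
have F0 : series (f^~ 0) ~> F x by have := fF 0; rewrite addr0 normc0; apply.
pose r h k := f k h - f k 0 - h * g k.
have [h hd h0] : exists2 h : R[i], normc h < d & h != 0.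
  by exists (d / 2)%:C; rewrite -?normc_gt0 normc_real gtr0_norm; lra.
have M0 k : 0 <= M k.
  have h2 : 0 < normc h ^+ 2 by rewrite exprn_gt0 ?normc_gt0.
  by rewrite -(pmulr_lge0 _ h2) (le_trans (normc_ge0 _) (fgM k h hd)).
have [G gG] : exists G : R[i], series g ~> G.
  have [|L rL] := @normc_series_cvg _ (r h).
    apply: (@series_leZ_cvg _ (normc h ^+ 2)) M_cvg => k /=; first exact: normc_ge0.
    by rewrite mulrC; exact: fgM.
  exists (h^-1 * (F (x + h) - F x - L)).
  apply: eq_cvgc _ (cvgcMl h^-1 (cvgcB (cvgcB (fF _ hd) F0) rL)) => n.
  rewrite /series /= -!sumrB mulr_sumr; apply: eq_bigr => k _.
  by rewrite /r; field.
suff -> : derive1 F x = G by [].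
apply: (@derive1_quadratic _ _ _ (limn (series M)) d d0) => {h0} h {}hd.
have := cvgcB (cvgcB (fF _ hd) F0) (cvgcMl h gG).
move/normc_cvg_le; apply => n; rewrite /series /= mulr_sumr -!sumrB.
apply: le_trans (ler_normc_sum _ _ _) _.
apply: (@le_trans _ _ (series M n * normc h ^+ 2)).
  by rewrite /series /= mulr_suml; apply: ler_sum => k _; exact: fgM.
rewrite ler_wpM2r ?exprn_ge0 ?normc_ge0 //.
by apply: nondecreasing_cvgn_le M_cvg n; apply: nondecreasing_series => k _ _.
Qed.

End ComplexDerivatives.

Lemma horner_taylor2 (S : comNzRingType) (p : {poly S}) (x h : S) (n : nat) :
  (size p <= n.+2)%N ->
  p.[x + h] = p.[x] + p^`().[x] * h + \sum_(i < n) p^`N(i.+2).[x] * h ^+ i.+2.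
Proof.
move=> sp; rewrite (nderiv_taylor_wide _ sp); last exact: mulrC.
by rewrite !big_ord_recl nderivn0 nderivn1 expr0 mulr1 expr1 addrA.
Qed.

Lemma ler_horner (S : numDomainType) (p q : {poly S}) (x : S) :
  0 <= x -> (forall i, p`_i <= q`_i) -> p.[x] <= q.[x].
Proof.
move=> x0 pq; rewrite (horner_coef_wide _ (leq_maxl (size p) (size q))).
rewrite (horner_coef_wide _ (leq_maxr (size p) (size q))).
by apply: ler_sum => i _; rewrite ler_wpM2r ?exprn_ge0.
Qed.

Section PolynomialMajorants.
Variable R : realType.
Implicit Types (p q : {poly R[i]}) (y h : R[i]) (r t : R).

Definition majorant p : {poly R} := map_poly (@normc R) p.

Lemma coef_majorant p i : (majorant p)`_i = normc p`_i.
Proof. by rewrite coef_map_id0 // normc0. Qed.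

Lemma majorant1 : majorant 1 = 1.
Proof.
by apply/polyP => i; rewrite coef_majorant !coef1; case: eqP => _; rewrite ?normc1 ?normc0.
Qed.

Lemma size_majorant p : (size (majorant p) <= size p)%N.
Proof. exact: size_poly. Qed.

Lemma majorant_horner_ge0 p r : 0 <= r -> 0 <= (majorant p).[r].
Proof.
move=> r0; rewrite -[0](horner0 r) ler_horner // => i.
by rewrite coef0 coef_majorant normc_ge0.
Qed.

Lemma normc_horner_le p y : normc p.[y] <= (majorant p).[normc y].
Proof.
rewrite horner_coef (horner_coef_wide _ (size_majorant p)).
apply: le_trans (ler_normc_sum _ _ _) _; apply: ler_sum => i _.
by rewrite normcM normcX coef_majorant.
Qed.

Lemma majorantM_le p q r : 0 <= r ->
  (majorant (p * q)).[r] <= (majorant p).[r] * (majorant q).[r].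
Proof.
move=> r0; rewrite -hornerM ler_horner // => i; rewrite coef_majorant !coefM.
apply: le_trans (ler_normc_sum _ _ _) _; apply: ler_sum => j _.
by rewrite normcM !coef_majorant.
Qed.

Lemma majorant_scaleXaddC (c a : R[i]) r :
  (majorant (c *: ('X + a%:P))).[r] = normc c * (r + normc a).
Proof.
have -> : majorant (c *: ('X + a%:P)) = normc c *: ('X + (normc a)%:P).
  apply/polyP => -[|[|i]]; rewrite coef_majorant !(coefZ, coefD, coefX, coefC) /= normcM.
  - by rewrite !add0r.
  - by rewrite !addr0 normc1.
  - by rewrite !addr0 normc0.
by rewrite !hornerE.
Qed.

Lemma majorant_nderivn n p : majorant p^`N(n) = (majorant p)^`N(n).
Proof. by apply/polyP => i; rewrite coef_majorant !coef_nderivn coef_majorant normcMn. Qed.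

Lemma majorant_nderivn_le n p r t : 0 <= r -> 0 <= t ->
  (majorant p^`N(n)).[t] * r ^+ n <= (majorant p).[t + r].
Proof.
move=> r0 t0; have [szn|nsz] := leqP (size (majorant p)) n.
  by rewrite majorant_nderivn nderivn_poly0 // horner0 mul0r majorant_horner_ge0 ?addr_ge0.
rewrite nderiv_taylor; last exact: mulrC.
rewrite (bigD1 (Ordinal nsz)) //= -majorant_nderivn lerDl sumr_ge0 // => i _.
by rewrite -majorant_nderivn mulr_ge0 ?exprn_ge0 ?majorant_horner_ge0.
Qed.

Lemma normc_coef_le p i r : 0 <= r -> normc p`_i * r ^+ i <= (majorant p).[r].
Proof.
move=> r0; have := majorant_nderivn_le i p r0 (lexx 0); rewrite add0r.
by rewrite horner_coef0 coef_majorant coef_nderivn addn0 binn mulr1n.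
Qed.

Lemma majorant_derivn_le n p r t : 0 <= r -> 0 <= t ->
  (majorant p^`(n)).[t] * r ^+ n <= n`!%:R * (majorant p).[t + r].
Proof.
move=> r0 t0; have -> : majorant p^`(n) = n`!%:R *: majorant p^`N(n).
  apply/polyP => i.
  by rewrite nderivn_def coef_majorant coefZ coefMn normcMn coef_majorant mulr_natl.
by rewrite hornerZ -mulrA ler_wpM2l // majorant_nderivn_le.
Qed.

Lemma poly_taylor2_le p y h r : normc h <= r ->
  normc (p.[y + h] - p.[y] - h * p^`().[y]) * r ^+ 2 <=
    normc h ^+ 2 * (majorant p).[normc y + r].
Proof.
move=> hr; have r0 : 0 <= r := le_trans (normc_ge0 h) hr.
have sp : (size p <= (size p).+2)%N by rewrite -addn2 leq_addr.
rewrite (horner_taylor2 _ _ sp) (horner_taylor2 _ _ (leq_trans (size_majorant p) sp)).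
have -> (a b s : R[i]) : a + b * h + s - a - h * b = s by ring.
have maj_ge0 := majorant_horner_ge0 p (normc_ge0 y).
have dmaj_ge0 : 0 <= (majorant p)^`().[normc y].
  by rewrite -nderivn1 -majorant_nderivn majorant_horner_ge0 ?normc_ge0.
rewrite mulrDr; apply: ler_wpDl; first by rewrite !(mulr_ge0, addr_ge0, exprn_ge0, normc_ge0).
apply: (le_trans (ler_wpM2r (exprn_ge0 2 r0) (ler_normc_sum _ _ _))).
rewrite mulr_suml mulr_sumr; apply: ler_sum => i _.
rewrite normcM normcX -majorant_nderivn -addn2 !exprD.
rewrite [leLHS](_ : _ = normc h ^+ 2 * r ^+ 2 *
  (normc p^`N(i + 2).[y] * normc h ^+ i)); last by ring.
rewrite [leRHS](_ : _ = normc h ^+ 2 * r ^+ 2 *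
  ((majorant p^`N(i + 2)).[normc y] * r ^+ i)); last by ring.
rewrite ler_wpM2l ?mulr_ge0 ?exprn_ge0 ?normc_ge0 // ler_pM ?exprn_ge0 ?normc_ge0 //.
  exact: normc_horner_le.
by rewrite lerXn2r ?nnegrE ?normc_ge0.
Qed.

Lemma derive1n_poly_series (a : nat -> R[i]) (p : nat -> {poly R[i]})
    (F : R[i] -> R[i]^o) (x : R[i]) r :
    cvgn [series normc (a k) * (majorant (p k)).[r]]_k ->
    (forall t : R[i], normc t < r -> series (fun k => a k * (p k).[t]) ~> F (x + t)) ->
  forall n (y : R[i]), normc y < r ->
    series (fun k => a k * (p k)^`(n).[y]) ~> derive1n n F (x + y).
Proof.
move=> maj_cvg aF; elim=> [|n IHn] y yr; first exact: aF.
pose s := (r - normc y) / 2; have s0 : 0 < s by rewrite divr_gt0 // subr_gt0.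
have yss : normc y + s + s = r by rewrite /s; field.
pose M k := n`!%:R / s ^+ n.+2 * (normc (a k) * (majorant (p k)).[r]).
rewrite derive1nS.
apply: (@derive1_series _ (fun k h => a k * (p k)^`(n).[y + h]) _ M _ _ s) => //.
- exact: is_cvg_seriesZ maj_cvg.
- move=> k h h_lt; rewrite addr0.
  have -> (b c d e : R[i]) : b * c - b * d - h * (b * e) = b * (c - d - h * e) by ring.
  rewrite normcM /M; have := poly_taylor2_le (p k)^`(n) y (ltW h_lt).
  have := majorant_derivn_le n (p k) (ltW s0) (addr_ge0 (normc_ge0 y) (ltW s0)).
  rewrite yss => maj_le taylor_le.
  rewrite [leRHS](_ : _ = normc (a k) *
    (normc h ^+ 2 * (n`!%:R * (majorant (p k)).[r]) / s ^+ n.+2)); last by ring.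
  rewrite ler_wpM2l ?normc_ge0 // ler_pdivlMr ?exprn_gt0 // -add2n exprD mulrA.
  apply: le_trans (ler_wpM2r (exprn_ge0 n (ltW s0)) taylor_le) _.
  by rewrite -mulrA ler_wpM2l ?exprn_ge0 ?normc_ge0.
- move=> h h_lt; rewrite -addrA; apply: IHn.
  by apply: le_lt_trans (le_normcD _ _) _; rewrite -yss; lra.
Qed.

End PolynomialMajorants.

Lemma ler_norm_lincomb (S : numDomainType) (c d u v B : S) : `|u| <= B -> `|v| <= B ->
  `|c * u + d * v| <= (`|c| + `|d|) * B.
Proof.
move=> uB vB; rewrite mulrDl; apply: le_trans (ler_normD _ _) _.
by rewrite !normrM lerD // ler_wpM2l.
Qed.

Section ComplexExponential.
Variable R : realType.
Implicit Types (z w : R[i]) (a b t : R).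

Lemma cexpD z w : cexp (z + w) = cexp z * cexp w.
Proof.
case: z w => a b [c d]; rewrite /cexp /= expRD cosD sinD; simpc.
by congr (_ +i* _); ring.
Qed.

Lemma normc_cexp z : normc (cexp z) = expR (complex.Re z).
Proof.
by rewrite /normc /cexp /= !exprMn -mulrDr cos2Dsin2 mulr1 sqrtr_sqr ger0_norm ?expR_ge0.
Qed.

Lemma cexp_neq0 z : cexp z != 0.
Proof. by rewrite -normc_gt0 normc_cexp expR_gt0. Qed.

Lemma taylor2_le (f df d2f : R -> R) (K t : R) :
    (forall x : R, is_derive x 1 f (df x)) -> (forall x : R, is_derive x 1 df (d2f x)) ->
    (forall x, 0 <= x <= t -> `|d2f x| <= K) -> 0 <= t ->
  `|f t - f 0 - df 0 * t| <= K * t ^+ 2.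
Proof.
have mvt (g g1 : R -> R) b : (forall x : R, is_derive x 1 g (g1 x)) -> 0 <= b ->
    exists2 c, 0 <= c <= b & g b - g 0 = g1 c * b.
  move=> dg b0; have cg : {within `[0, b], continuous g}.
    by apply: derivable_within_continuous => x _; exact: ex_derive.
  have [c] := MVT_segment b0 (fun x _ => dg x) cg.
  by rewrite in_itv subr0 => cb ->; exists c.
move=> f_df df_d2f d2f_le t0; have [c /andP[c0 ct] ->] := mvt _ _ _ f_df t0.
rewrite -mulrBl; have [d /andP[d0 dc] ->] := mvt _ _ _ df_d2f c0.
rewrite -mulrA !normrM expr2 (ger0_norm c0) (ger0_norm t0).
rewrite ler_pM ?mulr_ge0 ?ler_wpM2r // d2f_le // d0; exact: le_trans dc ct.
Qed.

#[local] Instance is_derive_mull a t : is_derive t 1 (fun t => a * t) a.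
Proof. by apply: is_derive_eq; rewrite /GRing.scale /= mulr1. Qed.

Lemma is_derive_expR_cos a b t :
  is_derive t 1 (fun t => expR (a * t) * cos (b * t))
    (a * (expR (a * t) * cos (b * t)) - b * (expR (a * t) * sin (b * t))).
Proof. by apply: is_derive_eq; rewrite /GRing.scale /=; ring. Qed.

Lemma is_derive_expR_sin a b t :
  is_derive t 1 (fun t => expR (a * t) * sin (b * t))
    (a * (expR (a * t) * sin (b * t)) + b * (expR (a * t) * cos (b * t))).
Proof. by apply: is_derive_eq; rewrite /GRing.scale /=; ring. Qed.

Lemma normr_expRM_le a c t : 0 <= t <= 1 -> `|c| <= 1 -> `|expR (a * t) * c| <= expR `|a|.
Proof.
move=> /andP[t0 t1] c1; rewrite normrM -[leRHS]mulr1 ler_pM //.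
rewrite ger0_norm ?expR_ge0 // ler_expR (le_trans (ler_norm _)) // normrM.
by rewrite (ger0_norm t0) ler_piMr.
Qed.

Lemma cexp_taylor2_ray z : exists K, forall t, 0 <= t <= 1 ->
  normc (cexp (z * t%:C) - 1 - z * t%:C) <= K * t ^+ 2.
Proof.
case: z => a b; pose f t := expR (a * t) * cos (b * t).
pose g t := expR (a * t) * sin (b * t).
have df t : is_derive t 1 f (a * f t + - b * g t).
  by have := is_derive_expR_cos a b t; rewrite mulNr.
have dg t : is_derive t 1 g (a * g t + b * f t) := is_derive_expR_sin a b t.
have f_le t : 0 <= t <= 1 -> `|f t| <= expR `|a|.
  by move=> t01; rewrite normr_expRM_le // ler_norml cos_geN1 cos_le1.
have g_le t : 0 <= t <= 1 -> `|g t| <= expR `|a|.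
  by move=> t01; rewrite normr_expRM_le // ler_norml sin_geN1 sin_le1.
have f0 : f 0 = 1 by rewrite /f !mulr0 expR0 cos0 mulr1.
have g0 : g 0 = 0 by rewrite /g !mulr0 sin0 mulr0.
pose K := (`|a| + `|b|) * ((`|a| + `|b|) * expR `|a|).
exists (K + K) => t /andP[t0 t1].
have t01 x : 0 <= x <= t -> 0 <= x <= 1 by move=> /andP[-> /le_trans]; apply.
have f_taylor : `|f t - 1 - a * t| <= K * t ^+ 2.
  have := @taylor2_le f _ _ K t df 
    (fun x => is_deriveD (is_deriveZ a (df x)) (is_deriveZ (- b) (dg x))).
  rewrite f0 g0 mulr0 mulr1 addr0; apply=> // x /t01 x01.
  rewrite /K -(normrN b); apply: ler_norm_lincomb.
    by rewrite ler_norm_lincomb ?f_le ?g_le.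
  by rewrite normrN ler_norm_lincomb ?f_le ?g_le.
have g_taylor : `|g t - b * t| <= K * t ^+ 2.
  have := @taylor2_le g _ _ K t dg 
    (fun x => is_deriveD (is_deriveZ a (dg x)) (is_deriveZ b (df x))).
  rewrite f0 g0 mulr0 mulr1 add0r subr0; apply=> // x /t01 x01.
  apply: ler_norm_lincomb; first by rewrite ler_norm_lincomb ?f_le ?g_le.
  by rewrite -(normrN b) ler_norm_lincomb ?f_le ?g_le.
rewrite mulrDl; apply: le_trans (normc_le_ReIm _) _; simpc => /=.
exact: lerD.
Qed.

End ComplexExponential.

Section NonPoles.
Variable R : realType.
Implicit Types (z h : R[i]).

Definition nonpole z := forall j : nat, z <> - j%:R.

Lemma nonpole_neq0 z j : nonpole z -> z + j%:R != 0.
Proof. by move=> z_np; rewrite addr_eq0; apply/eqP. Qed.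

Lemma nonpoleDn z j : nonpole z -> nonpole (z + j%:R).
Proof.
by move=> z_np k /eqP; rewrite -addr_eq0 -addrA -natrD (negPf (nonpole_neq0 _ z_np)).
Qed.

Lemma Re_gt0_nonpole z : 0 < complex.Re z -> nonpole z.
Proof.
move=> z0 j zj; move: z0; rewrite zj -(rmorph_nat (real_complex R)) /=.
by rewrite oppr_gt0 ltrn0.
Qed.

Lemma nonpole_normc_ge z : nonpole z ->
  exists2 c : R, 0 < c & forall k : nat, c * k.+1%:R <= normc (z + k%:R).
Proof.
move=> z_np; pose u k := (z + k%:R) / k.+1%:R.
have u1 : u ~> 1.
  apply: (@cvg_normc_le _ _ _ (fun n => normc (z - 1) / n.+1%:R)); last first.
    by rewrite -[0](mulr0 (normc (z - 1))); exact: cvgMl_tmp cvg_harmonic.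
  move=> k; rewrite (_ : u k - 1 = (z - 1) / k.+1%:R); last first.
    by rewrite /u -natr1; field; rewrite natr1 pnatr_eq0.
  by rewrite normcM normcV normc_nat.
have u0 k : u k != 0 by rewrite mulf_neq0 ?invr_eq0 ?pnatr_eq0 ?nonpole_neq0.
have [c c0 cu] := cvg_neq0_bounded_below u1 (oner_neq0 _) u0; exists c => // k.
by have := cu k; rewrite normcM normcV normc_nat ler_pdivlMr.
Qed.

Lemma nonpole_normc_ge_near z : nonpole z -> exists2 c : R, 0 < c &
  forall h, normc h < c -> forall k : nat, c * k.+1%:R <= normc (z + h + k%:R).
Proof.
move=> /nonpole_normc_ge[c c0 z_ge]; exists (c / 2) => [|h hc k]; first by rewrite divr_gt0.
have := z_ge k; have := lerB_normcD (z + k%:R) h; rewrite [_ + h]addrAC.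
have : c / 2 <= c / 2 * k.+1%:R by rewrite ler_peMr ?ler1n ?divr_ge0 ?(ltW c0).
lra.
Qed.

Lemma normc_ge_nonpole z (c : R) : 0 < c ->
  (forall k : nat, c * k.+1%:R <= normc (z + k%:R)) -> nonpole z.
Proof.
move=> c0 z_ge j zj; have := z_ge j; rewrite zj addNr normc0.
by apply/negP; rewrite -ltNge mulr_gt0.
Qed.

Lemma prod_nonpole_neq0 z n : nonpole z -> \prod_(0 <= j < n) (z + j%:R) != 0.
Proof. by move=> z_np; rewrite prodf_seq_neq0; apply/allP => j _; exact: nonpole_neq0. Qed.

End NonPoles.

Section EulerLimit.
Variable R : realType.
Implicit Types (z w : R[i]).

Definition euler_seq z n : R[i] :=
  n`!%:R * natcpow n z / \prod_(0 <= j < n.+1) (z + j%:R).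

Lemma natcpowD n z w : natcpow n (z + w) = natcpow n z * natcpow n w :> R[i].
Proof. by rewrite /natcpow mulrDl cexpD. Qed.

Lemma euler_seq_neq0 z n : nonpole z -> euler_seq z n != 0.
Proof.
by move=> z_np; rewrite !mulf_neq0 ?invr_eq0 ?prod_nonpole_neq0 ?cexp_neq0.
Qed.

Definition ln_step n : R := ln n.+2%:R - ln n.+1%:R.

Lemma ln_step_bounds n : n.+2%:R^-1 <= ln_step n <= n.+1%:R^-1.
Proof.
have ln_diff_le (a b : R) : 0 < a -> 0 < b -> ln a - ln b <= (a - b) / b.
  move=> a0 b0; rewrite -ln_div ?posrE //.
  have -> : a / b = 1 + (a - b) / b by field; rewrite gt_eqF.
  rewrite le_ln1Dx // mulrBl divff ?gt_eqF //; have := divr_gt0 a0 b0; lra.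
rewrite /ln_step; apply/andP; split.
  rewrite -lerN2 opprB; apply: le_trans (ln_diff_le _ _ _ _) _ => //.
  by rewrite -[n.+2%:R]natr1 opprD addrA subrr sub0r mulN1r.
apply: le_trans (ln_diff_le _ _ _ _) _ => //.
by rewrite -[n.+2%:R]natr1 addrAC subrr add0r mul1r.
Qed.

Definition euler_ratio z n : R[i] := n.+2%:R * cexp (z * (ln_step n)%:C) / (z + n.+2%:R).

Lemma euler_seqS z n : nonpole z -> euler_seq z n.+2 = euler_seq z n.+1 * euler_ratio z n.
Proof.
move=> z_np; rewrite /euler_seq /euler_ratio factS natrM big_nat_recr //=.
have -> : natcpow n.+2 z = natcpow n.+1 z * cexp (z * (ln_step n)%:C).
  by rewrite /natcpow -cexpD -mulrDr -rmorphD /= /ln_step addrC subrK.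
by rewrite invfM; ring.
Qed.

Lemma cexp_ln_step_le z : exists K : R, forall n,
  normc (cexp (z * (ln_step n)%:C) - 1 - z / n.+2%:R) <= K * n.+1%:R ^- 2.
Proof.
have [K cexp_le] := cexp_taylor2_ray z.
have K0 : 0 <= K.
  have := cexp_le 1; rewrite expr1n mulr1 ler01 lexx => /(_ isT).
  exact/le_trans/normc_ge0.
exists (K + normc z) => n; have /andP[step_ge step_le] := ln_step_bounds n.
have step_ge0 : 0 <= ln_step n by apply: le_trans step_ge; rewrite invr_ge0.
have step_le1 : ln_step n <= 1 by rewrite (le_trans step_le) // invf_le1 ?ler1n.
have -> : cexp (z * (ln_step n)%:C) - 1 - z / n.+2%:R =
    (cexp (z * (ln_step n)%:C) - 1 - z * (ln_step n)%:C) + z * (ln_step n - n.+2%:R^-1)%:C.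
  by rewrite (rmorphB _ (ln_step n)) fmorphV rmorph_nat /=; ring.
apply: le_trans (le_normcD _ _) _; rewrite mulrDl lerD //.
  rewrite (le_trans (cexp_le _ _)) ?step_ge0 // -exprVn ler_wpM2l //.
  by rewrite lerXn2r ?nnegrE ?invr_ge0.
rewrite normcM normc_real ler_wpM2l ?normc_ge0 // ger0_norm ?subr_ge0 //.
apply: le_trans (lerB step_le (lexx _)) _.
rewrite -[n.+2%:R]natr1; have := ltr0Sn R n; move: (n.+1%:R : R) => x x0.
rewrite [leLHS](_ : _ = (x * (x + 1))^-1); last by field; rewrite !gt_eqF //; lra.
by rewrite lef_pV2 ?posrE ?mulr_gt0 ?exprn_gt0 //; nra.
Qed.

Lemma euler_ratio_cvg z : nonpole z -> cvgn [series normc (euler_ratio z k - 1)]_k.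
Proof.
move=> z_np; have [c c0 z_ge] := nonpole_normc_ge z_np.
have [K cexp_le] := cexp_ln_step_le z.
apply: (@series_leZ_cvg _ (c^-1 * K)) (@series_inv_sqr_cvg R) => n /=.
  exact: normc_ge0.
have zn0 := nonpole_neq0 n.+2 z_np.
have -> : euler_ratio z n - 1 = n.+2%:R / (z + n.+2%:R) *
    (cexp (z * (ln_step n)%:C) - 1 - z / n.+2%:R).
  have n0 : n.+2%:R != 0 :> R[i] by rewrite pnatr_eq0.
  by rewrite /euler_ratio; move: n.+2%:R n0 zn0 => x x0 zx0; field; rewrite x0 zx0.
rewrite normcM -mulrA ler_pM ?normc_ge0 // normcM normcV normc_nat.
rewrite ler_pdivrMr ?normc_gt0 // ler_pdivlMl // (le_trans _ (z_ge n.+2)) //.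
by rewrite ler_wpM2l ?(ltW c0) // ler_nat.
Qed.

Lemma euler_seq_cvg z : nonpole z -> exists2 l : R[i], euler_seq z ~> l & l != 0.
Proof.
move=> z_np; have ratio0 n : euler_ratio z n != 0.
  by rewrite !mulf_neq0 ?invr_eq0 ?cexp_neq0 ?nonpole_neq0 ?pnatr_eq0.
have [l zl l0] := prod_cvg_neq0 (euler_ratio_cvg z_np) ratio0.
exists (euler_seq z 1 * l); last by rewrite mulf_neq0 ?euler_seq_neq0.
rewrite -cvg_shiftS; apply: eq_cvgc _ (cvgcMl (euler_seq z 1) zl).
by elim=> [|n IHn]; rewrite ?big_ord0 ?mulr1 // big_ord_recr mulrA IHn /= -euler_seqS.
Qed.

Lemma euler_seq_cvg_Gamma z : nonpole z -> euler_seq z ~> Gamma z.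
Proof. by move=> /euler_seq_cvg[l zl _]; rewrite /Gamma (cvgc_lim zl). Qed.

Lemma Gamma_neq0 z : nonpole z -> Gamma z != 0.
Proof. by move=> /euler_seq_cvg[l zl l0]; rewrite /Gamma (cvgc_lim zl). Qed.

Lemma inv_natcpow_cvg0 z : 0 < complex.Re z -> (fun n => (natcpow n z)^-1) ~> 0.
Proof.
move=> z0; apply/cvg_normcP.
have lnoo : complex.Re z * ln n%:R @[n --> \oo] --> +oo.
  apply/cvgryPge => A; near=> n; rewrite -ler_pdivrMl // -(expRK (_ * A)).
  rewrite ler_ln ?posrE ?expR_gt0 //.
    by near: n; exact: nbhs_infty_ger.
  by rewrite ltr0n; near: n; exact: nbhs_infty_gt.
have := cvg_comp _ _ lnoo (@cvgr_expR R).
rewrite (@eq_cvg _ _ _ _ (fun n => normc ((natcpow n z)^-1 - 0))) // => n.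
rewrite subr0 normcV normc_cexp /= -expRN; congr expR.
by case: z {z0 lnoo} => a b /=; rewrite mulr0 subr0.
Unshelve. all: by end_near. Qed.

Lemma fact_div_prod_cvg0 z : 0 < complex.Re z ->
  (fun n => n`!%:R / \prod_(0 <= j < n.+1) (z + j%:R)) ~> 0.
Proof.
move=> z0; rewrite -(mulr0 (Gamma z)).
apply: eq_cvgc _ (cvgcM (euler_seq_cvg_Gamma (Re_gt0_nonpole z0)) (inv_natcpow_cvg0 z0)) => n.
rewrite /euler_seq /=; field; rewrite cexp_neq0 prod_nonpole_neq0 //.
exact: Re_gt0_nonpole.
Qed.

Lemma Gamma_quot_cvg (x s : R[i]) : nonpole (x + 1) -> nonpole s -> nonpole (x + s + 1) ->
  (fun n => n`!%:R * \prod_(0 <= j < n.+1) (x + s + 1 + j%:R) /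
    (\prod_(0 <= j < n.+1) (x + 1 + j%:R) * \prod_(0 <= j < n.+1) (s + j%:R))) ~>
  Gamma_quot x s.
Proof.
move=> x_np s_np xs_np.
apply: eq_cvgc _ (cvgcM (cvgcM (euler_seq_cvg_Gamma x_np) (euler_seq_cvg_Gamma s_np))
  (cvgcV (Gamma_neq0 xs_np) (euler_seq_cvg_Gamma xs_np))) => n.
have -> : x + s + 1 = (x + 1) + s by rewrite addrAC.
have n0 : n`!%:R != 0 :> R[i] by rewrite pnatr_eq0 -lt0n fact_gt0.
rewrite /euler_seq (natcpowD _ (x + 1)) /=; field.
by rewrite n0 !cexp_neq0 !prod_nonpole_neq0 // addrAC.
Qed.

End EulerLimit.

Lemma size_monicB (S : nzRingType) (p q : {poly S}) n : p \is monic -> q \is monic ->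
  size p = n.+1 -> size q = n.+1 -> (size (p - q)%R <= n)%N.
Proof.
move=> /monicP mp /monicP mq sp sq; apply/leq_sizeP => j.
rewrite leq_eqVlt => /predU1P[<-|nj].
  by move: mp mq; rewrite coefB !lead_coefE sp sq /= => -> ->; rewrite subrr.
by rewrite coefB !nth_default ?subrr // ?sp ?sq.
Qed.

Section PartialFractions.
Variable F : fieldType.
Implicit Types (w z : nat -> F) (s : F).

Lemma prod_div_partial_fractions w z n s : injective z -> (forall j, s != z j) ->
  \prod_(j < n.+1) (s - w j) / \prod_(j < n.+1) (s - z j) =
  1 + \sum_(k < n.+1) \prod_(j < n.+1) (z k - w j) /
        \prod_(j < n.+1 | j != k) (z k - z j) / (s - z k).
Proof.
move=> z_inj sz; pose P (v : nat -> F) : {poly F} := \prod_(j < n.+1) ('X - (v j)%:P).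
have PE v t : (P v).[t] = \prod_(j < n.+1) (t - v j).
  by rewrite horner_prod; apply: eq_bigr => j _; rewrite hornerXsubC.
have size_P v : size (P v) = n.+2.
  by rewrite size_prod_XsubC /index_enum -enumT size_enum_ord.
have size_d : (size (P w - P z)%R <= n.+1)%N.
  by rewrite size_monicB ?monic_prod_XsubC.
have Pz0 : \prod_(j < n.+1) (s - z j) != 0 by apply/prodf_neq0 => j _; rewrite subr_eq0.
have := congr1 (horner^~ s) (lagrange_gen (ltn0Sn n) z_inj size_d).
rewrite hornerD hornerN !PE horner_sum => /(canRL (subrK _)) ->.
rewrite mulrDl divff // addrC mulr_suml; congr (_ + _); apply: eq_bigr => k _.
rewrite hornerM hornerC lagrangeE //= hornerM hornerC hornerD hornerN !PE.
have -> : \prod_(j < n.+1) (z k - z j) = 0 by rewrite (bigD1 k) //= subrr mul0r.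
rewrite !horner_prod subr0.
under eq_bigr do rewrite hornerXsubC.
under [\prod_(j < _ | _) _.[s]]eq_bigr do rewrite hornerXsubC.
rewrite [\prod_(j < n.+1) (s - z j)](bigD1 k) //= invfM -!mulrA; congr (_ * (_ * _)).
rewrite mulrC mulfVK //; by apply/prodf_neq0 => j _; rewrite subr_eq0.
Qed.

End PartialFractions.

Section FactorialProducts.
Variable S : comNzRingType.
Implicit Types (n k : nat) (x : S).

Lemma prod_natrB k : \prod_(j < k) (j%:R - k%:R : S) = (-1) ^+ k * k`!%:R.
Proof.
rewrite (reindex_inj rev_ord_inj) /= fact_prod big_add1 big_mkord natr_prod.
rewrite -[X in _ ^+ X]card_ord -prodrN; apply: eq_bigr => i _.
by rewrite natrB // addrAC subrr sub0r.
Qed.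

Lemma prod_natrB_neq n k : (k <= n)%N ->
  \prod_(j < n.+1 | j != k :> nat) (j%:R - k%:R : S) = (-1) ^+ k * (k`! * (n - k)`!)%:R.
Proof.
move=> kn; rewrite -(big_mkord (fun j => j != k) (fun j => j%:R - k%:R)).
rewrite (@big_cat_nat _ _ _ k) //=; last exact: leqW.
rewrite [in X in _ * X]big_ltn_cond ?ltnS // eqxx /=.
have -> : \prod_(0 <= i < k | i != k) (i%:R - k%:R : S) = (-1) ^+ k * k`!%:R.
  rewrite -prod_natrB -(big_mkord xpredT (fun i => i%:R - k%:R)).
  by apply: congr_big_nat => // i /andP[_ /ltn_eqF ->].
have -> : \prod_(k.+1 <= i < n.+1 | i != k) (i%:R - k%:R : S) = (n - k)`!%:R.
  rewrite -add1n big_addn subSn // fact_prod natr_prod.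
  apply: congr_big_nat => // i; last by rewrite natrD addrK.
  by case/andP=> i0 _; rewrite -{2}[k]add0n eqn_add2r -lt0n.
by rewrite natrM mulrA.
Qed.

Lemma prod_shift x n k : (k <= n.+1)%N ->
  \prod_(j < n.+1) (x + 1 + j%:R - k%:R) * \prod_(i < k) (x + 1 + (n - i)%:R) =
  \prod_(j < n.+1) (x + 1 + j%:R) * \prod_(i < k) (x - i%:R).
Proof.
elim: k => [|k IHk] kn.
  by rewrite !big_ord0; congr (_ * _); apply: eq_bigr => j _; rewrite subr0.
rewrite ![\prod_(i < k.+1) _]big_ord_recr /= !mulrA -IHk ?(ltnW kn) //.
rewrite mulrAC [RHS]mulrAC; congr (_ * _).
rewrite [X in _ = X * _]big_ord_recr big_ord_recl /= natrB // -[k.+1%:R]natr1.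
under eq_bigr do rewrite /bump add1n -natr1.
rewrite [RHS](_ : _ = (x - k%:R) *
  (\prod_(j < n) (x + 1 + j%:R - k%:R) * (x + 1 + (n%:R - k%:R)))); last by ring.
rewrite mulrA; congr (_ * _ * _); first by ring.
by apply: eq_bigr => j _; ring.
Qed.

End FactorialProducts.

Section GeneralizedBinomials.
Variable F : fieldType.
Implicit Types (x y : F) (k : nat).

Definition gbin x k : F := \prod_(i < k) ((x - i%:R) / i.+1%:R).

Definition gbin_poly x k : {poly F} :=
  \prod_(i < k) (i.+1%:R^-1 *: ('X + (x - i%:R)%:P)).

Lemma gbin_polyE x k y : (gbin_poly x k).[y] = gbin (x + y) k.
Proof.
rewrite horner_prod; apply: eq_bigr => i _.
by rewrite hornerZ hornerD hornerX hornerC mulrC addrA [y + x]addrC.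
Qed.

Lemma gbin_polyS x k :
  gbin_poly x k.+1 = k.+1%:R^-1 *: (('X + (x - k%:R)%:P) * gbin_poly x k).
Proof. by rewrite /gbin_poly big_ord_recr /= mulrC scalerAl. Qed.

Lemma coef0_gbin_polyS x k :
  (gbin_poly x k.+1)`_0 = (x - k%:R) * (gbin_poly x k)`_0 / k.+1%:R.
Proof. by rewrite gbin_polyS coefZ mulrDl coefD coefXM coefCM add0r mulrC. Qed.

Lemma coefS_gbin_polyS x k i : (gbin_poly x k.+1)`_i.+1 =
  ((x - k%:R) * (gbin_poly x k)`_i.+1 + (gbin_poly x k)`_i) / k.+1%:R.
Proof. by rewrite gbin_polyS coefZ mulrDl coefD coefXM coefCM addrC mulrC. Qed.

End GeneralizedBinomials.

Section BetaPartialFractions.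
Variable R : realType.
Implicit Types (x s : R[i]).

Definition euler_weight x n k : R[i] :=
  \prod_(i < k) ((n - i)%:R / (x + 1 + (n - i)%:R)).

Lemma euler_residue x n k : (k <= n)%N -> nonpole (x + 1) ->
  n`!%:R / \prod_(j < n.+1) (x + 1 + j%:R) *
    (\prod_(j < n.+1) (x + 1 + j%:R - k%:R) / ((-1) ^+ k * (k`! * (n - k)`!)%:R)) =
  (-1) ^+ k * gbin x k * euler_weight x n k.
Proof.
move=> kn x_np; have xP0 := prod_nonpole_neq0 n.+1 x_np; rewrite big_mkord in xP0.
have w0 : \prod_(i < k) (x + 1 + (n - i)%:R) != 0.
  by apply/prodf_neq0 => i _; exact: nonpole_neq0.
have f0 m : m`!%:R != 0 :> R[i] by rewrite pnatr_eq0 -lt0n fact_gt0.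
rewrite (canRL (mulfK w0) (prod_shift x (leqW kn))) /gbin /euler_weight !big_split /= !prodfV.
have -> : \prod_(i < k) (i.+1%:R : R[i]) = k`!%:R.
  by rewrite fact_prod big_add1 natr_prod big_mkord.
have -> : \prod_(i < k) ((n - i)%:R : R[i]) = n`!%:R / (n - k)`!%:R.
  by apply: (canRL (mulfK (f0 _))); rewrite -natr_prod -ffact_prod -natrM ffact_fact.
have sign_inv : ((-1) ^+ k)^-1 = (-1) ^+ k :> R[i] by rewrite -exprVn invrN invr1.
rewrite natrM !invfM sign_inv; field.
by rewrite xP0 w0 !f0.
Qed.

Lemma Gamma_quot_seq_partial_fractions x s n : nonpole (x + 1) -> nonpole s ->
  n`!%:R * \prod_(0 <= j < n.+1) (x + s + 1 + j%:R) /
    (\prod_(0 <= j < n.+1) (x + 1 + j%:R) * \prod_(0 <= j < n.+1) (s + j%:R)) =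
  n`!%:R / \prod_(0 <= j < n.+1) (x + 1 + j%:R) +
    \sum_(k < n.+1) (-1) ^+ k * gbin x k * euler_weight x n k / (s + k%:R).
Proof.
move=> x_np s_np; have xP0 := prod_nonpole_neq0 n.+1 x_np; rewrite !big_mkord in xP0 *.
have node_inj : injective (fun j => - j%:R : R[i]).
  by move=> i j /eqP; rewrite eqr_opp eqr_nat => /eqP.
have s_node j : s != - j%:R by apply/eqP/s_np.
have := prod_div_partial_fractions (fun j => - (x + 1 + j%:R)) n node_inj s_node.
under eq_bigr do rewrite opprK; under [\prod_(j < n.+1) (s - _)]eq_bigr do rewrite opprK.
have -> : \prod_(j < n.+1) (s + (x + 1 + j%:R)) = \prod_(j < n.+1) (x + s + 1 + j%:R).
  by apply: eq_bigr => j _; ring.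
rewrite invfM mulrACA mulrC => ->; rewrite mulrDr mulr1 mulr_sumr; congr (_ + _).
apply: eq_bigr => k _; have kn : (k <= n)%N by rewrite -ltnS.
have := euler_residue kn x_np; rewrite -prod_natrB_neq // opprK => <-.
by rewrite -[RHS]mulrA; congr (_ * (_ / _ / _)); apply: eq_bigr => j _; ring.
Qed.

Lemma natr_le_normcD (z : R[i]) (a : nat) : 0 <= complex.Re z -> a%:R <= normc (z + a%:R).
Proof.
move=> z0; apply: le_trans (le_trans (ler_norm _) (Re_le_normc _)).
by rewrite -(rmorph_nat (real_complex R)); case: z z0 => u v /= u0; rewrite lerDr.
Qed.

Lemma euler_weight_le1 x n k : 0 < complex.Re (x + 1) -> normc (euler_weight x n k) <= 1.
Proof.
move=> x0; rewrite normc_prod; apply: prodr_ile1 => i _; rewrite normc_ge0 /=.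
rewrite normcM normcV normc_nat ler_pdivrMr ?mul1r ?natr_le_normcD ?ltW //.
by rewrite normc_gt0 nonpole_neq0 //; exact: Re_gt0_nonpole.
Qed.

Lemma natr_div_cvg1 (z : R[i]) : 0 < complex.Re z -> (fun n => n%:R / (z + n%:R)) ~> 1.
Proof.
move=> z0; have zn0 n : z + n%:R != 0 by apply: nonpole_neq0; exact: Re_gt0_nonpole.
rewrite -cvg_shiftS; apply: (@cvg_normc_le _ _ _ (fun n => normc z / n.+1%:R)); last first.
  by rewrite -[0](mulr0 (normc z)); exact: cvgMl_tmp cvg_harmonic.
move=> n /=; rewrite (_ : _ - 1 = - z / (z + n.+1%:R)); last first.
  by have := zn0 n.+1; move: (n.+1%:R : R[i]) => t zt0; field.
rewrite normcM normcN normcV ler_wpM2l ?normc_ge0 // lef_pV2 ?posrE ?normc_gt0 //.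
by rewrite natr_le_normcD // ltW.
Qed.

Lemma euler_weight_cvg1 x k : 0 < complex.Re (x + 1) -> (fun n => euler_weight x n k) ~> 1.
Proof.
move=> x0; elim: k => [|k IHk].
  by apply: eq_cvgc _ (cvgc_cst 1) => n; rewrite /euler_weight big_ord0.
have factor : (fun n => (n - k)%:R / (x + 1 + (n - k)%:R)) ~> 1.
  by rewrite -(cvg_shiftn k); apply: eq_cvgc _ (natr_div_cvg1 x0) => n; rewrite /= addnK.
have := cvgcM IHk factor; rewrite mulr1; apply: eq_cvgc => n.
by rewrite /euler_weight big_ord_recr.
Qed.

End BetaPartialFractions.

Section NewtonSeries.
Variable R : realType.
Implicit Types (x s y : R[i]) (n k : nat) (r : R).

Definition gbin_bound x r k : R := \prod_(i < k) ((r + normc (x - i%:R)) / i.+1%:R).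

Lemma majorant_gbin_poly_le x k r : 0 <= r ->
  (majorant (gbin_poly x k)).[r] <= gbin_bound x r k.
Proof.
move=> r0; elim: k => [|k IHk].
  by rewrite /gbin_poly /gbin_bound !big_ord0 majorant1 hornerC.
rewrite /gbin_poly /gbin_bound !big_ord_recr /=.
apply: le_trans (majorantM_le _ _ r0) _; rewrite majorant_scaleXaddC normcV normc_nat.
by rewrite [_^-1 * _]mulrC ler_wpM2r ?divr_ge0 ?addr_ge0 ?normc_ge0.
Qed.

Lemma gbin_bound_ge0 x r k : 0 <= r -> 0 <= gbin_bound x r k.
Proof. by move=> r0; apply: prodr_ge0 => i _; rewrite divr_ge0 ?addr_ge0 ?normc_ge0. Qed.

(* For [k >= n] the bounds [b k] satisfy [b k - b k.+1 >= (1 - r) * b k / k.+1]. *)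
Lemma gbin_bound_series_cvg n r : 0 <= r < 1 ->
  cvgn [series gbin_bound n%:R r k / k.+1%:R]_k.
Proof.
move=> /andP[r0 r1]; have b0 k := gbin_bound_ge0 n%:R k r0.
apply: (@series_le_telescope_cvg _ n _ (fun k => gbin_bound n%:R r k / (1 - r))) => [k|k|k nk].
- by rewrite divr_ge0.
- by rewrite divr_ge0 // subr_ge0 ltW.
rewrite -mulrBl ler_pdivlMr ?subr_gt0 //.
rewrite [gbin_bound n%:R r k.+1]big_ord_recr /= -/(gbin_bound n%:R r k).
rewrite normc_distC -natrB // normc_nat natrB // -natr1.
have k1 : (k%:R + 1 : R) != 0 by rewrite natr1 pnatr_eq0.
rewrite -subr_ge0 (_ : _ - _ = gbin_bound n%:R r k * n%:R / (k%:R + 1)); last by field.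
by rewrite divr_ge0 ?mulr_ge0.
Qed.

Definition newton_coef s k : R[i] := (-1) ^+ k / (s + k%:R).

Lemma newton_majorant_cvg n s r : nonpole s -> 0 <= r < 1 ->
  cvgn [series normc (newton_coef s k) * (majorant (gbin_poly n%:R k)).[r]]_k.
Proof.
move=> s_np /[dup] r01 /andP[r0 _].
have [c c0 s_ge] := nonpole_normc_ge s_np.
apply: (@series_leZ_cvg _ c^-1) (@gbin_bound_series_cvg n _ r01) => k /=.
  by rewrite mulr_ge0 ?normc_ge0 ?majorant_horner_ge0.
rewrite normcM normc_sign mul1r normcV mulrCA [leLHS]mulrC -invfM.
by rewrite ler_pM ?invr_ge0 ?normc_ge0 ?majorant_horner_ge0 ?majorant_gbin_poly_le //
  lef_pV2 ?posrE ?mulr_gt0 // normc_gt0 nonpole_neq0.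
Qed.

Lemma newton_series n y s : normc y < 1 -> nonpole s -> nonpole (s + y) ->
  series (fun k => newton_coef s k * (gbin_poly n%:R k).[y]) ~> Gamma_quot (n%:R + y) s.
Proof.
move=> y1 s_np sy_np; set x := n%:R + y.
have x0 : 0 < complex.Re (x + 1).
  have := le_lt_trans (Re_le_normc y) y1; rewrite ltr_norml /x => /andP[y_gt _].
  have := ler0n R n; rewrite -(rmorph_nat (real_complex R)).
  by case: (y) y_gt => u v /=; lra.
have xs_np : nonpole (x + s + 1).
  by rewrite (_ : _ + 1 = s + y + n.+1%:R); [exact: nonpoleDn|rewrite /x -natr1; ring].
pose a k := newton_coef s k * (gbin_poly n%:R k).[y].
have majorant_cvg :
    cvgn [series normc (newton_coef s k) * (majorant (gbin_poly n%:R k)).[normc y]]_k.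
  by apply: newton_majorant_cvg; rewrite ?normc_ge0.
have a_le k : normc (a k) <=
    normc (newton_coef s k) * (majorant (gbin_poly n%:R k)).[normc y].
  by rewrite normcM ler_wpM2l ?normc_ge0 // normc_horner_le.
have [|L aL] := @normc_series_cvg _ a.
  apply: series_le_cvg majorant_cvg => k //=; first exact: normc_ge0.
  by rewrite mulr_ge0 ?majorant_horner_ge0 ?normc_ge0.
have weighted : (fun N => series (fun k => a k * euler_weight x N.-1 k) N) ~> L.
  apply: tannery majorant_cvg _ aL => [N k|k].
    by apply: le_trans (a_le k); rewrite normcM ler_piMr ?normc_ge0 // euler_weight_le1.
  have weight1 : (fun N => euler_weight x N.-1 k) ~> 1.
    by rewrite -cvg_shiftS; exact: euler_weight_cvg1.
  by have := cvgcMl (a k) weight1; rewrite mulr1.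
suff <- : L = Gamma_quot x s by [].
apply: cvgc_unique (Gamma_quot_cvg (Re_gt0_nonpole x0) s_np xs_np).
have := weighted; rewrite -cvg_shiftS => /(cvgcD (fact_div_prod_cvg0 x0)).
rewrite add0r; apply: eq_cvgc => N.
rewrite Gamma_quot_seq_partial_fractions //; last exact: Re_gt0_nonpole.
rewrite /= seriesEord /=; congr (_ + _); apply: eq_bigr => k _.
by rewrite /a /newton_coef gbin_polyE; ring.
Qed.

Lemma Gamma_quot_derive1n n s i : nonpole s ->
  series (fun k => newton_coef s k * ((gbin_poly n%:R k)`_i *+ i`!)) ~>
    derive1n i (fun x : R[i] => Gamma_quot x s) n%:R.
Proof.
move=> s_np; have [c c0 s_ge] := nonpole_normc_ge_near s_np.
pose r : R := Num.min c 2^-1.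
have r0 : 0 < r by rewrite lt_min c0 invr_gt0 ltr0n.
have r1 : r < 1 by rewrite gt_min invf_lt1 ?ltr1n ?orbT.
have newton_cvg t : normc t < r ->
    series (fun k => newton_coef s k * (gbin_poly n%:R k).[t]) ~> Gamma_quot (n%:R + t) s.
  move=> tr; apply: newton_series => //; first exact: lt_trans tr r1.
  by apply: (normc_ge_nonpole c0) => k; apply: s_ge; move: tr; rewrite lt_min => /andP[].
have majorant_cvg :
    cvgn [series normc (newton_coef s k) * (majorant (gbin_poly n%:R k)).[r]]_k.
  by apply: newton_majorant_cvg => //; rewrite r1 ltW.
have := @derive1n_poly_series R _ _ (fun x => Gamma_quot x s) n%:R r
  majorant_cvg newton_cvg i 0.
rewrite normc0 addr0 => /(_ r0).
apply: eq_cvgc => N; apply: eq_bigr => k _.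
by rewrite horner_coef0 coef_derivn addn0 ffactnn.
Qed.

End NewtonSeries.

Section StieltjesSeries.
Variable R : realType.
Implicit Types (s t u h : R[i]).

Lemma exprVn_1D_taylor2 q : exists2 K : R, 0 <= K & forall t, normc t <= 2^-1 ->
  normc ((1 + t) ^- q - 1 + q%:R * t) <= K * normc t ^+ 2.
Proof.
elim: q => [|q [K K0 taylor_le]].
  by exists 0 => // t _; rewrite expr0 invr1 subrr add0r mul0r normc0 mul0r.
exists (2 * (K + q.+1%:R)) => [|t t2]; first by rewrite mulr_ge0 ?addr_ge0.
have t1_ge : 2^-1 <= normc (1 + t).
  by have := lerB_normcD 1 t; rewrite normc1; lra.
have t1_neq0 : 1 + t != 0 by rewrite -normc_gt0; apply: lt_le_trans t1_ge; rewrite invr_gt0.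
rewrite (_ : _ + _ = ((1 + t) ^- q - 1 + q%:R * t + q.+1%:R * t ^+ 2) / (1 + t)); last first.
  by rewrite exprS invfM -natr1; field; rewrite t1_neq0 expf_neq0.
rewrite normcM normcV ler_pdivrMr ?normc_gt0 //.
apply: (@le_trans _ _ ((K + q.+1%:R) * normc t ^+ 2)).
  apply: le_trans (le_normcD _ _) _; rewrite mulrDl lerD ?taylor_le //.
  by rewrite normcM normc_nat normcX.
rewrite [leRHS](_ : _ = (K + q.+1%:R) * normc t ^+ 2 * (2 * normc (1 + t))); last by ring.
by rewrite ler_peMr ?(mulr_ge0, addr_ge0, exprn_ge0, normc_ge0) //; lra.
Qed.

Lemma exprVn_taylor2 q : exists2 K : R, 0 <= K &
  forall u h, u != 0 -> normc h <= normc u / 2 ->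
    normc ((u + h) ^- q - u ^- q + q%:R * h * u ^- q.+1) <=
      K * normc u ^- q.+2 * normc h ^+ 2.
Proof.
have [K K0 taylor_le] := exprVn_1D_taylor2 q; exists K => // u h u0 hu.
have nu0 : normc u != 0 by rewrite gt_eqF // normc_gt0.
have /taylor_le taylor_hu : normc (h / u) <= 2^-1.
  by rewrite normcM normcV ler_pdivrMr ?normc_gt0 // mulrC.
have -> : (u + h) ^- q - u ^- q + q%:R * h * u ^- q.+1 =
    u ^- q * ((1 + h / u) ^- q - 1 + q%:R * (h / u)).
  have -> : u + h = u * (1 + h / u) by field.
  by rewrite exprMn invfM exprS invfM; ring.
rewrite normcM normcV normcX [leRHS](_ : _ = normc u ^- q * (K * normc (h / u) ^+ 2)).
  by rewrite ler_wpM2l // invr_ge0 exprn_ge0 ?normc_ge0.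
by rewrite normcM normcV -[q.+2]addn2 exprD; field; rewrite nu0 expf_neq0.
Qed.

Lemma normc_exprVn_le (c : R) s k q : 0 < c -> c * k.+1%:R <= normc (s + k%:R) ->
  normc (s + k%:R) ^- q.+1 <= c ^- q.+1 / k.+1%:R.
Proof.
move=> c0 s_ge; have ck0 : 0 < c * k.+1%:R by rewrite mulr_gt0.
apply: (@le_trans _ _ ((c * k.+1%:R) ^- q.+1)).
  have s0 : 0 < normc (s + k%:R) := lt_le_trans ck0 s_ge.
  by rewrite lef_pV2 ?posrE ?exprn_gt0 // lerXn2r // nnegrE ltW.
rewrite exprMn invfM ler_wpM2l ?invr_ge0 ?exprn_ge0 ?(ltW c0) //.
by rewrite lef_pV2 ?posrE ?exprn_gt0 // exprS ler_peMr // exprn_ege1 // ler1n.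
Qed.

Lemma derive1n_stieltjes_series (e : nat -> R[i]) (F : R[i] -> R[i]^o) :
    cvgn [series normc (e k) / k.+1%:R]_k ->
    (forall s, nonpole s -> series (fun k => e k / (s + k%:R)) ~> F s) ->
  forall m s, nonpole s ->
    series (fun k => (-1) ^+ m * m`!%:R * (e k / (s + k%:R) ^+ m.+1)) ~> derive1n m F s.
Proof.
move=> e_cvg eF; elim=> [|m IHm] s s_np.
  apply: eq_cvgc _ (eF s s_np) => N; apply: eq_bigr => k _.
  by rewrite expr0 !mul1r expr1.
have [c c0 sh_ge] := nonpole_normc_ge_near s_np.
have [K K0 taylor_le] := exprVn_taylor2 m.+1.
have s_ge k : c * k.+1%:R <= normc (s + k%:R).
  by have := sh_ge 0; rewrite normc0 addr0; apply.
pose a k := (-1) ^+ m * m`!%:R * e k.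
pose M k := m`!%:R * K * c ^- m.+3 * (normc (e k) / k.+1%:R).
rewrite derive1nS.
apply: (@derive1_series _
  (fun k h => (-1) ^+ m * m`!%:R * (e k / (s + h + k%:R) ^+ m.+1)) _ M _ _ (c / 2)).
- by rewrite divr_gt0.
- exact: is_cvg_seriesZ e_cvg.
- move=> k h hc; rewrite addr0.
  have u0 : s + k%:R != 0 by exact: nonpole_neq0.
  have hu : normc h <= normc (s + k%:R) / 2.
    apply: le_trans (ltW hc) _; rewrite ler_pM2r ?invr_gt0 //; apply: le_trans (s_ge k).
    by rewrite ler_peMr ?ler1n // ltW.
  rewrite (_ : _ - _ - _ = a k * ((s + k%:R + h) ^- m.+1 - (s + k%:R) ^- m.+1 +
    m.+1%:R * h * (s + k%:R) ^- m.+2)); last first.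
    rewrite /a factS natrM [(-1) ^+ m.+1]exprS [s + h + _]addrAC.
    move: ((s + k%:R + h) ^- _) ((s + k%:R) ^- m.+1) ((s + k%:R) ^- m.+2) => A B C; ring.
  rewrite normcM; apply: le_trans (ler_wpM2l (normc_ge0 _) (taylor_le _ _ u0 hu)) _.
  rewrite /a /M !normcM normc_sign mul1r normc_nat.
  rewrite [leLHS](_ : _ = m`!%:R * normc (e k) * K * normc h ^+ 2 *
    normc (s + k%:R) ^- m.+3); last by ring.
  rewrite [leRHS](_ : _ = m`!%:R * normc (e k) * K * normc h ^+ 2 *
    (c ^- m.+3 / k.+1%:R)); last by ring.
  by rewrite ler_wpM2l ?normc_exprVn_le // ?mulr_ge0 ?exprn_ge0 ?normc_ge0.
- move=> h hc; apply: IHm; apply: (normc_ge_nonpole c0) => k; apply: sh_ge.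
  by apply: lt_le_trans hc _; rewrite ler_pdivrMr // ler_peMr ?ler1n ?(ltW c0).
Qed.

End StieltjesSeries.

Section BinomialTaylorCoefficients.
Variable R : realType.
Implicit Types (n k : nat).
Local Notation H := (gharm R 1).
Local Notation H2 := (gharm R 2).

Lemma gharm0 a : gharm R a 0 = 0.
Proof. by rewrite /gharm big_geq. Qed.

Lemma gharmS a k : gharm R a k.+1 = gharm R a k + k.+1%:R ^- a.
Proof. by rewrite /gharm big_nat_recr. Qed.

Lemma coef_gbin_poly_le n k : (k <= n)%N ->
  [/\ (gbin_poly n%:R k)`_0 = 'C(n, k)%:R :> R[i],
      (gbin_poly n%:R k)`_1 = 'C(n, k)%:R * (H n - H (n - k)) &
      (gbin_poly n%:R k)`_2 *+ 2 =
        'C(n, k)%:R * ((H n - H (n - k)) ^+ 2 - (H2 n - H2 (n - k)))].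
Proof.
elim: k => [|k IHk] kn.
  by rewrite /gbin_poly big_ord0 subn0 !subrr expr0n subrr !mulr0 bin0 !coefC mul0rn.
have {IHk}[] := IHk (ltnW kn).
have [j nkj] : exists j, (n - k = j.+1)%N by exists (n - k.+1)%N; rewrite -subSn.
have nk : n%:R - k%:R = j.+1%:R :> R[i] by rewrite -natrB ?nkj // ltnW.
have k0 : k.+1%:R != 0 :> R[i] by rewrite pnatr_eq0.
have j0 : j.+1%:R != 0 :> R[i] by rewrite pnatr_eq0.
have binS : 'C(n, k.+1)%:R = j.+1%:R * 'C(n, k)%:R / k.+1%:R :> R[i].
  by apply: (canRL (mulfK k0)); rewrite -!natrM mulnC mul_bin_left nkj.
rewrite subnS nkj /= !gharmS expr1 coef0_gbin_polyS !coefS_gbin_polyS nk binS.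
move: (j.+1%:R : R[i]) (k.+1%:R : R[i]) ('C(n, k)%:R : R[i]) k0 j0 => a b C b0 a0.
move: (gbin_poly _ k)`_0 (gbin_poly _ k)`_1 (gbin_poly _ k)`_2 => c0 c1 c2 -> -> c2E.
have {c2E} -> : c2 = C * ((H n - (H j + a^-1)) ^+ 2 - (H2 n - (H2 j + (a ^+ 2)^-1))) / 2.
  by rewrite -c2E; field.
by split; field; rewrite ?a0 ?b0.
Qed.

Lemma coef_gbin_poly_gt n j :
  let c := (-1) ^+ j / (j.+1%:R * 'C(n + j.+1, j.+1)%:R) in
  [/\ (gbin_poly n%:R (n + j.+1))`_0 = 0 :> R[i],
      (gbin_poly n%:R (n + j.+1))`_1 = c &
      (gbin_poly n%:R (n + j.+1))`_2 = c * (H n - H j)].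
Proof.
elim: j => [|j [IH0 IH1 IH2]] /=.
  have [coef0 coef1 _] := coef_gbin_poly_le (leqnn n).
  rewrite addn1 coef0_gbin_polyS !coefS_gbin_polyS subrr !mul0r !add0r coef0 coef1.
  by rewrite subnn gharm0 binn bin1 expr0 !mul1r subr0 mulrC.
rewrite addnS coef0_gbin_polyS !coefS_gbin_polyS IH0 IH1 IH2 mulr0 mul0r.
have -> : n%:R - (n + j.+1)%:R = - j.+1%:R :> R[i].
  by rewrite natrD opprD addrA subrr add0r.
have bin_diag : j.+2%:R * 'C((n + j.+1).+1, j.+2)%:R =
    (n + j.+1).+1%:R * 'C(n + j.+1, j.+1)%:R :> R[i].
  by rewrite -!natrM mul_bin_diag.
have j0 : j.+1%:R != 0 :> R[i] by rewrite pnatr_eq0.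
have b0 : (n + j.+1).+1%:R != 0 :> R[i] by rewrite pnatr_eq0.
have c0 : 'C(n + j.+1, j.+1)%:R != 0 :> R[i] by rewrite pnatr_eq0 -lt0n bin_gt0 leq_addl.
rewrite bin_diag gharmS expr1 exprS.
move: (j.+1%:R : R[i]) ((n + j.+1).+1%:R : R[i]) ('C(n + j.+1, j.+1)%:R : R[i]) j0 b0 c0.
move=> a b C a0 b0 c0.
by split => //; field; rewrite a0 b0 c0.
Qed.

(* [(d^2/dx^2 - 2 H_n d/dx) binom(x, k)] at [x = n]. *)
Definition gbin_diff_op n k : R[i] :=
  (gbin_poly n%:R k)`_2 *+ 2 - 2 * H n * (gbin_poly n%:R k)`_1.

Lemma gbin_diff_op_le n k : (k <= n)%N ->
  gbin_diff_op n k =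
    - ('C(n, k)%:R * (H n ^+ 2 + H2 n - H (n - k) ^+ 2 - H2 (n - k))).
Proof. by move=> /coef_gbin_poly_le[_ c1 c2]; rewrite /gbin_diff_op c1 c2; ring. Qed.

Lemma gbin_diff_op_gt n j :
  gbin_diff_op n (n + j.+1) =
    - 2 * ((-1) ^+ j * H j / (j.+1%:R * 'C(n + j.+1, j.+1)%:R)).
Proof.
by have [_ c1 c2] := coef_gbin_poly_gt n j; rewrite /gbin_diff_op c1 c2; ring.
Qed.

Lemma gbin_diff_op_series_cvg n :
  cvgn [series normc ((-1) ^+ k * gbin_diff_op n k) / k.+1%:R]_k.
Proof.
have half_lt1 : 0 <= (2^-1 : R) < 1 by rewrite invr_ge0 ler0n invf_lt1 ?ltr1n.
have b_cvg := @gbin_bound_series_cvg _ n _ half_lt1.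
apply: (@series_leZ_cvg _ (8 + 4 * normc (H n))) b_cvg => k /=.
  by rewrite divr_ge0 ?normc_ge0.
rewrite normcM normc_sign mul1r mulrA ler_wpM2r ?invr_ge0 //.
have coef_le i : normc (gbin_poly n%:R k)`_i <= 2 ^+ i * gbin_bound n%:R (2^-1 : R) k.
  have half0 : 0 <= 2^-1 :> R by rewrite invr_ge0.
  rewrite mulrC -ler_pdivrMr ?exprn_gt0 // -exprVn.
  exact: le_trans (normc_coef_le _ _ half0) (majorant_gbin_poly_le _ _ half0).
apply: le_trans (ler_normcB _ _) _; rewrite normcMn !normcM normc_nat.
have := coef_le 2%N; have := ler_wpM2l (normc_ge0 (H n)) (coef_le 1%N); lra.
Qed.

End BinomialTaylorCoefficients.

Section DifferentiatedNewtonSeries.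
Variable R : realType.
Implicit Types (p s : R[i]) (m n k : nat).
Local Notation H := (gharm R 1).
Local Notation H2 := (gharm R 2).

Lemma Gamma_quot_diff_op_series n s : nonpole s ->
  series (fun k => (-1) ^+ k * gbin_diff_op R n k / (s + k%:R)) ~>
    derive1n 2 (fun x : R[i] => Gamma_quot x s) n%:R
      - 2 * H n * derive1n 1 (fun x : R[i] => Gamma_quot x s) n%:R.
Proof.
move=> s_np; have derive_cvg i := @Gamma_quot_derive1n R n s i s_np.
apply: eq_cvgc _ (cvgcB (derive_cvg 2%N) (cvgcMl (2 * H n) (derive_cvg 1%N))) => N.
rewrite /series /= mulr_sumr -sumrB; apply: eq_bigr => k _.
by rewrite /newton_coef /gbin_diff_op -[1`!]/1%N -[2`!]/2%N; ring.
Qed.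

Definition newton_term p m n k : R[i] :=
  2^-1 * ((-1) ^+ k * gbin_diff_op R n k / (p + k%:R) ^+ m.+1).

Lemma newton_term_series p m n : nonpole p ->
  series (newton_term p m n) ~> (-1) ^+ m / (2 * m`!%:R) *
    derive1n m (fun s : R[i] =>
      (derive1n 2 (fun x : R[i] => Gamma_quot x s) n%:R
       - 2 * H n * derive1n 1 (fun x : R[i] => Gamma_quot x s) n%:R) : R[i]^o) p.
Proof.
move=> p_np; have mf0 : m`!%:R != 0 :> R[i] by rewrite pnatr_eq0 -lt0n fact_gt0.
have := @derive1n_stieltjes_series R _ _ (@gbin_diff_op_series_cvg R n)
  (@Gamma_quot_diff_op_series n) m p p_np.
move=> /(cvgcMl ((-1) ^+ m / (2 * m`!%:R))); apply: eq_cvgc => N.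
rewrite /series /= mulr_sumr; apply: eq_bigr => k _.
transitivity ((-1) ^+ m * (-1) ^+ m * newton_term p m n k).
  by rewrite /newton_term; field; rewrite mf0 expf_neq0 ?nonpole_neq0.
by rewrite -expr2 sqrr_sign mul1r.
Qed.

Lemma series_newton_term_head p m n :
  2^-1 * (\sum_(0 <= k < n.+1) (-1) ^+ k / (p + k%:R) ^+ m.+1 * 'C(n, k)%:R
      * (H n ^+ 2 + H2 n - H (n - k) ^+ 2 - H2 (n - k))) =
  - series (newton_term p m n) n.+1.
Proof.
rewrite /series /= mulr_sumr -sumrN; apply: eq_big_nat => k /andP[_ kn].
by rewrite /newton_term gbin_diff_op_le //; ring.
Qed.

Lemma newton_term_tail p m n j : nonpole p ->
  newton_term p m n (n + j.+1) =
  (-1) ^+ n * H j / (j.+1%:R * (p + n%:R + j.+1%:R) ^+ m.+1 * 'C(n + j.+1, j.+1)%:R).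
Proof.
move=> p_np; rewrite /newton_term gbin_diff_op_gt natrD addrA exprD [(-1) ^+ j.+1]exprS.
have j0 : j.+1%:R != 0 :> R[i] by rewrite pnatr_eq0.
have bin0 : 'C(n + j.+1, j.+1)%:R != 0 :> R[i] by rewrite pnatr_eq0 -lt0n bin_gt0 leq_addl.
have pow0 : (p + n%:R + j.+1%:R) ^+ m.+1 != 0.
  by rewrite expf_neq0 // -addrA -natrD nonpole_neq0.
move: (j.+1%:R : R[i]) ('C(n + j.+1, j.+1)%:R : R[i]) ((p + n%:R + j.+1%:R) ^+ m.+1)
  j0 bin0 pow0 => c b a c0 b0 a0.
transitivity ((-1) ^+ j * (-1) ^+ j * ((-1) ^+ n * H j / (c * a * b))).
  by field; rewrite a0 b0 c0.
by rewrite -expr2 sqrr_sign mul1r.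
Qed.

End DifferentiatedNewtonSeries.

Theorem theorem3p9 (R : realType) (p : R[i]) (m n : nat)
    (hp : forall j : nat, p <> - j%:R) :
  (\sum_(1 <= k < N)
      ((-1) ^+ n * gharm R 1 k.-1
       / (k%:R * (p + n%:R + k%:R) ^+ m.+1 * 'C(n + k, k)%:R)) : R[i]^o)
    @[N --> \oo] -->
  (2^-1 * (\sum_(0 <= k < n.+1)
      (-1) ^+ k / (p + k%:R) ^+ m.+1 * 'C(n, k)%:R
      * (gharm R 1 n ^+ 2 + gharm R 2 n
         - gharm R 1 (n - k) ^+ 2 - gharm R 2 (n - k)))
   + (-1) ^+ m / (2 * m`!%:R)
     * derive1n m (fun s : R[i] =>
         (derive1n 2 (fun x : R[i] => Gamma_quot x s) n%:R
          - 2 * gharm R 1 n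
            * derive1n 1 (fun x : R[i] => Gamma_quot x s) n%:R) : R[i]^o) p
   : R[i]^o).
Proof.
rewrite series_newton_term_head [- _ + _]addrC -cvg_shiftS.
have := cvgcB (cvgc_shiftn n.+1 (@newton_term_series R p m n hp))
  (cvgc_cst (series (newton_term p m n) n.+1)).
apply: eq_cvgc => N; rewrite /= sub_series_geq ?leq_addl //.
rewrite -[X in \sum_(X <= _ < _) _]add0n big_addn addnK big_add1 /=.
by apply: eq_bigr => j _; rewrite [(j + n.+1)%N]addnC addSnnS newton_term_tail.
Qed.
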